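(* Let $\mathbb{F}_q$ be the finite field with $q$ elements, of characteristic different from $2$. The number $N_4(\mathbb{F}_q)$ of $\sim$-equivalence classes in $\mathcal{TM}_4$ (over $\mathbb{F}_q$) is given by: (i) $N_4(\mathbb{F}_q)=(3q+23)/4$ if $q\equiv 3\pmod 4$; (ii) $N_4(\mathbb{F}_q)=(3q+25)/4$ if $q\equiv 1\pmod 4$.
   Context: Let $\mathbb{F}$ be a field of characteristic different from $2$. For $n\geq 2$, $\mathcal{TM}_n$ denotes the set of all strictly lower triangular $n\times n$ matrices with entries in $\mathbb{F}$. For $T=[t_{ij}]\in\mathcal{TM}_n$, $\mathcal{A}(T)$ is the commutative (unital, associative) $\mathbb{F}$-algebra given by generators $X_1,\dots,X_n$ and relations $X_1^2=0$ and $X_i^2=\sum_{j<i}t_{ij}X_jX_i$ for $2\leq i\leq n$; it is graded by $\deg(X_i)=2$. For $T,S\in\mathcal{TM}_n$ write $T\sim S$ if there is a degree preserving isomorphism of graded $\mathbb{F}$-algebras $\mathcal{A}(T)\to\mathcal{A}(S)$; this is an equivalence relation, and $N_n(\mathbb{F})$ is the number of its equivalence classes in $\mathcal{TM}_n$. *)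

(* Defs.v *)
From HB Require Import structures.
From mathcomp Require Import all_boot all_order all_algebra.
From mathcomp Require Import generic_quotient ring_quotient.
From mathcomp Require Import boolp.
From mathcomp Require Import mpoly.

Set Implicit Arguments.
Unset Strict Implicit.
Unset Printing Implicit Defensive.

Import GRing.Theory.
Local Open Scope ring_scope.
Local Open Scope quotient_scope.

Section PresentedAlgebra.
Variables (F : fieldType) (n : nat).
Implicit Types T : 'M[F]_n.

Definition strictly_lower T : bool :=
  [forall i : 'I_n, forall j : 'I_n, (i <= j)%N ==> (T i j == 0)].

(* Indices run over 0, ..., n - 1; for i = 0 the sum is empty, so the first
   relation reads X_0 ^ 2 = 0. *)
Definition relator T (i : 'I_n) : {mpoly F[n]} :=
  'X_i ^+ 2 - \sum_(j < n | (j < i)%N) T i j *: ('X_j * 'X_i).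

Definition in_rel_ideal T (p : {mpoly F[n]}) : Prop :=
  exists a : 'I_n -> {mpoly F[n]}, p = \sum_i a i * relator T i.

Definition rel_ideal T : {pred {mpoly F[n]}} := fun p => `[< in_rel_ideal T p >].

Lemma rel_ideal_closed T : idealr_closed (rel_ideal T).
Proof.
split.
- by apply/asboolP; exists (fun=> 0); rewrite big1 // => i _; rewrite mul0r.
- apply/asboolP => -[a /(congr1 (fun p => p.@[fun=> 0]))].
  rewrite rmorph1 rmorph_sum big1 => [/eqP|i _]; first by rewrite oner_eq0.
  rewrite rmorphM rmorphB rmorph_sum big1 => [|j _].
    by rewrite rmorphXn /= mevalXU expr2 mul0r subrr mulr0.
  by rewrite /= mevalZ rmorphM /= !mevalXU !mulr0.
- move=> c p q /asboolP[a ->] /asboolP[b ->].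
  apply/asboolP; exists (fun i => c * a i + b i).
  rewrite mulr_sumr -big_split; apply: eq_bigr => i _ /=.
  by rewrite mulrDl mulrA.
Qed.

HB.instance Definition _ T :=
  isIdealr.Build {mpoly F[n]} (rel_ideal T) (rel_ideal_closed T).

Definition alg T : Type := {ideal_quot (rel_ideal T)}.

HB.instance Definition _ T := GRing.ComNzRing.on (alg T).
HB.instance Definition _ T := Quotient.on (alg T).

Definition alg_pi T (p : {mpoly F[n]}) : alg T := \pi_{ideal_quot (rel_ideal T)} p.

Lemma alg_piD T : {morph alg_pi T : p q / p + q}.
Proof. exact: rmorphD. Qed.

Lemma alg_piM T : {morph alg_pi T : p q / p * q}.
Proof. exact: rmorphM. Qed.

Lemma alg_pi1 T : alg_pi T 1 = 1.
Proof. exact: rmorph1. Qed.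

Definition alg_scale T (c : F) (x : alg T) : alg T := alg_pi T c%:MP * x.

Lemma alg_scaleA T a b (x : alg T) :
  alg_scale a (alg_scale b x) = alg_scale (a * b) x.
Proof. by rewrite /alg_scale mulrA mpolyCM alg_piM. Qed.

Lemma alg_scale1 T : left_id 1 (@alg_scale T).
Proof. by move=> x; rewrite /alg_scale alg_pi1 mul1r. Qed.

Lemma alg_scaleDr T : right_distributive (@alg_scale T) +%R.
Proof. by move=> a x y; rewrite /alg_scale mulrDr. Qed.

Lemma alg_scaleDl T (x : alg T) :
  {morph (@alg_scale T)^~ x : a b / a + b}.
Proof. by move=> a b; rewrite /alg_scale mpolyCD alg_piD mulrDl. Qed.

HB.instance Definition _ T := GRing.Zmodule_isLmodule.Build F (alg T)
  (@alg_scaleA T) (@alg_scale1 T) (@alg_scaleDr T) (@alg_scaleDl T).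

Lemma alg_scaleAl T (a : F) (x y : alg T) : a *: (x * y) = a *: x * y.
Proof. exact: mulrA. Qed.

HB.instance Definition _ T :=
  GRing.Lmodule_isLalgebra.Build F (alg T) (@alg_scaleAl T).
HB.instance Definition _ T := GRing.Lalgebra_isComAlgebra.Build F (alg T).

(* The degree-d component: images of the polynomials all of whose monomials
   have degree d, where every variable has degree 2. *)
Definition alg_homog T (d : nat) (x : alg T) : Prop :=
  exists p : {mpoly F[n]},
    (forall m, m \in msupp p -> (2 * mdeg m)%N = d) /\ x = alg_pi T p.

End PresentedAlgebra.

Definition graded_iso (F : fieldType) (n : nat) (T S : 'M[F]_n) : Prop :=
  exists f : {lrmorphism alg T -> alg S},
    bijective f /\ forall d x, alg_homog d x -> alg_homog d (f x).

(* N_n(F), for F finite. *)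
Definition num_classes (F : finFieldType) (n : nat) : nat :=
  #|equivalence_partition (fun T S : 'M[F]_n => `[< graded_iso T S >])
      [set T : 'M[F]_n | strictly_lower T]|.

(* Main.v *)
Require Import Defs.
From mathcomp Require Import all_boot all_order all_algebra.
From HB Require Import structures.
From mathcomp Require Import generic_quotient ring_quotient boolp mpoly.
From mathcomp Require Import ring zify.

Set Implicit Arguments.
Unset Strict Implicit.
Unset Printing Implicit Defensive.

Import GRing.Theory.
Local Open Scope ring_scope.

(* A graded isomorphism is a linear change of variables carrying the span of the
   quadratic relators of T to that of S. Completing the squares in rank 4, every
   such span becomes that of
     x1^2, x2^2, x3^2 - c x1 x2, x4^2 - u x1 x2 - v x1 x3 - w x2 x3
   with u = 2ab + g^2 c, v = 2ag, w = 2bg. If c and (u, v, w) are nonzero, the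
   lines of square-zero elements and the elements whose square lies in their
   product are so few that an isomorphism can only rescale and permute the
   variables. This leaves six isolated classes and the family
   (2e, 2 + 2e, 2, 2), e != 0, in which e is identified with 1/e exactly when e
   is a square. The number of squares fixed by inversion is 1 or 2, and the
   parity of (q - 1)/2 decides which. *)

(** * Graded isomorphisms and quadratic forms *)

Section FormSystems.
Variables (F : fieldType) (n : nat).

(** Forms are functions of a column vector, not polynomials; quadratic forms lose nothing by this
    once 2 is invertible ([is_quad_eq0]). *)
Definition forms := 'I_n -> 'cV[F]_n -> F.

Implicit Types A B C : forms.

(* The change of variables g carries the span of the A i to that of the B j. *)
Definition change_forms A B (g M : 'M[F]_n) :=
  [/\ g \in unitmx, M \in unitmx
    & forall i x, A i (g *m x) = \sum_j M i j * B j x].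

Definition equiv_forms A B := exists g M, change_forms A B g M.

Lemma equiv_forms_refl A : equiv_forms A A.
Proof.
exists 1%:M, 1%:M; split; rewrite ?unitmx1 // => i x.
rewrite mul1mx (bigD1 i) //= big1 => [|j /negPf nij].
  by rewrite mxE eqxx mul1r addr0.
by rewrite mxE eq_sym nij mul0r.
Qed.

Lemma change_formsV A B (g M : 'M[F]_n) : g \in unitmx -> M \in unitmx ->
  (forall i x, A i (g *m x) = \sum_j M i j * B j x) ->
  forall i x, B i (invmx g *m x) = \sum_j invmx M i j * A j x.
Proof.
move=> ug uM AB i x.
have VM k : \sum_j invmx M i j * M j k = (i == k)%:R.
  by have /matrixP/(_ i k) := mulVmx uM; rewrite !mxE.
transitivity (\sum_j invmx M i j * \sum_k M j k * B k (invmx g *m x)).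
  under [RHS]eq_bigr do rewrite mulr_sumr.
  rewrite exchange_big /= (bigD1 i) //= [X in _ + X]big1 => [|k ki];
    under eq_bigr do rewrite mulrA; rewrite -mulr_suml VM.
    by rewrite eqxx mul1r addr0.
  by rewrite eq_sym (negPf ki) mul0r.
by apply: eq_bigr => j _; rewrite -AB mulKVmx.
Qed.

Lemma equiv_forms_sym A B : equiv_forms A B -> equiv_forms B A.
Proof.
move=> [g [M [ug uM AB]]]; exists (invmx g), (invmx M).
by split; rewrite ?unitmx_inv //; apply: change_formsV.
Qed.

Lemma change_formsM A B C g M h N :
  change_forms A B g M -> change_forms B C h N ->
  change_forms A C (g *m h) (M *m N).
Proof.
move=> [ug uM AB] [uh uN BC]; split; rewrite ?unitmx_mul ?ug ?uM // => i x.
rewrite -mulmxA AB; under eq_bigr do rewrite BC mulr_sumr.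
rewrite exchange_big; apply: eq_bigr => k _ /=; rewrite mxE mulr_suml.
by apply: eq_bigr => j _; rewrite mulrA.
Qed.

Lemma equiv_forms_trans A B C :
  equiv_forms A B -> equiv_forms B C -> equiv_forms A C.
Proof.
move=> [g [M AB]] [h [N BC]]; exists (g *m h), (M *m N).
exact: change_formsM AB BC.
Qed.

End FormSystems.

(** * Graded isomorphisms as changes of variables between relator spans *)

Section GradedIso.
Variables (F : fieldType) (n : nat).
Hypothesis two_neq0 : 2%:R != 0 :> F.
Implicit Types (T S : 'M[F]_n) (p : {mpoly F[n]}).

Definition rel_form T : forms F n := fun i x =>
  x i 0 ^+ 2 - \sum_(j < n | (j < i)%N) T i j * (x j 0 * x i 0).


HB.instance Definition _ T := GRing.isZmodMorphism.Build {mpoly F[n]} (alg T)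
  (@alg_pi F n T) (fun p q => rmorphB _ p q).
HB.instance Definition _ T := GRing.isMonoidMorphism.Build {mpoly F[n]} (alg T)
  (@alg_pi F n T) (alg_pi1 T, alg_piM T).

Lemma alg_piZ T : scalable (@alg_pi F n T).
Proof. by move=> c p; rewrite -mul_mpolyC rmorphM. Qed.

HB.instance Definition _ T := GRing.isScalable.Build F {mpoly F[n]} (alg T) _
  (@alg_pi F n T) (@alg_piZ T).

Lemma alg_piK T : cancel (repr : alg T -> {mpoly F[n]}) (@alg_pi F n T).
Proof. exact: reprK. Qed.

Lemma alg_pi_eq0 T p : alg_pi T p = 0 <-> in_rel_ideal T p.
Proof.
rewrite -(rmorph0 (@alg_pi F n T)); split=> [/eqP|ip].
  by rewrite -Quotient.idealrBE subr0 => /asboolP.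
by apply/eqP; rewrite -Quotient.idealrBE subr0; apply/asboolP.
Qed.

(* Restriction to the line through x: reading off powers of 'X separates the
   homogeneous components even though F is finite. *)
Definition on_line (x : 'cV[F]_n) : {mpoly F[n]} -> {poly F} :=
  mmap (@polyC F) (fun k => (x k 0)%:P * 'X).
HB.instance Definition _ x := GRing.RMorphism.on (on_line x).

Lemma on_lineX x k : on_line x 'X_k = (x k 0)%:P * 'X.
Proof. by rewrite /on_line mmapX mmap1U. Qed.

Lemma on_lineZ x c p : on_line x (c *: p) = c *: on_line x p.
Proof. by rewrite /on_line mmapZ mul_polyC. Qed.

Lemma on_line_coef0 x p : (on_line x p)`_0 = p.@[fun=> 0].
Proof.
rewrite -horner_coef0 /on_line /mmap horner_sum mevalE; apply: eq_bigr => m _.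
rewrite hornerM hornerC horner_prod; congr (_ * _); apply: eq_bigr => k _.
by rewrite horner_exp hornerM hornerX mulr0.
Qed.

Definition linp (v : 'rV[F]_n) : {mpoly F[n]} := \sum_k v 0 k *: 'X_k.

Lemma on_line_linp x v : on_line x (linp v) = ((v *m x) 0 0)%:P * 'X.
Proof.
rewrite rmorph_sum mxE rmorph_sum mulr_suml; apply: eq_bigr => k _ /=.
by rewrite on_lineZ on_lineX -mul_polyC mulrA -polyCM.
Qed.

Lemma on_line_relator T x i :
  on_line x (relator T i) = (rel_form T i x)%:P * 'X^2.
Proof.
rewrite rmorphB rmorphXn rmorph_sum /= on_lineX polyCB mulrBl; congr (_ - _).
  by rewrite exprMn polyC_exp.
rewrite rmorph_sum mulr_suml; apply: eq_bigr => j _ /=.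
by rewrite on_lineZ rmorphM /= !on_lineX -mul_polyC !polyCM; ring.
Qed.

Lemma linp_homog p :
  (forall m, m \in msupp p -> (2 * mdeg m)%N = 2) ->
  p = linp (\row_k p@_U_(k)).
Proof.
move=> homp; apply/mpolyP=> m; rewrite raddf_sum /=.
have [/mdeg1P[i /eqP->]|dm] := boolP (mdeg m == 1%N).
  rewrite (bigD1 i) //= big1 => [|k ki]; rewrite mcoeffZ mcoeffXU ?mxE.
    by rewrite eqxx mulr1 addr0.
  by rewrite (negPf ki) mulr0.
rewrite big1 => [|k _].
  apply: memN_msupp_eq0; apply: contra dm => /homp; lia.
rewrite mcoeffZ mcoeffX; have [km|_] := eqVneq U_(k)%MM m; last by rewrite mulr0.
by rewrite -km mdeg1 eqxx in dm.
Qed.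

(** At the k-th basis vector all products of distinct coordinates vanish, so only the k-th form is
    nonzero. *)
Lemma rel_form_free T (v : 'rV[F]_n) :
  (forall x, \sum_i v 0 i * rel_form T i x = 0) -> v = 0.
Proof.
move=> v0; apply/rowP=> k; rewrite mxE -(v0 (delta_mx k 0)).
rewrite (bigD1 k) //= big1 => [|i ik]; rewrite /rel_form !mxE.
  rewrite !eqxx big1 => [|j /ltn_eqF jk]; first by rewrite subr0 expr1n mulr1 addr0.
  by rewrite mxE -val_eqE jk mul0r mulr0.
by rewrite (negPf ik) big1 => [|j _]; rewrite ?subr0 ?expr0n /= ?mulr0 // !mulr0.
Qed.

(** The relators are quadratic, so the ideal has no linear part and only the constant terms of the
    cofactors reach degree 2. *)
Lemma coef_on_line_ideal T (a : 'I_n -> {mpoly F[n]}) x :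
  let p := on_line x (\sum_i a i * relator T i) in
  p`_1 = 0 /\ p`_2 = \sum_i (a i).@[fun=> 0] * rel_form T i x.
Proof.
rewrite /= rmorph_sum !coef_sum big1 => [|i _].
  split=> //; apply: eq_bigr => i _.
  by rewrite rmorphM /= on_line_relator mulrA coefMXn /= coefMC on_line_coef0.
by rewrite rmorphM /= on_line_relator mulrA coefMXn.
Qed.

Lemma graded_iso_equiv_forms T S :
  graded_iso T S -> equiv_forms (rel_form T) (rel_form S).
Proof.
case=> f [bij_f hom_f].
(* The component of degree 2 consists of linear forms, so each variable goes to one; these are the
   rows of g. *)
have linX i : exists v, f (alg_pi T 'X_i) = alg_pi S (linp v).
  have /hom_f[p [/linp_homog -> ->]] : alg_homog 2 (alg_pi T 'X_i).
    by exists 'X_i; split=> // m; rewrite msuppX inE => /eqP->; rewrite mdeg1.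
  by eexists.
have [r fX] := choice linX; pose g := \matrix_i r i.
have rg i (x : 'cV_n) : (r i *m x) 0 0 = (g *m x) i 0.
  by rewrite -[in LHS](rowK r i) -row_mul mxE.
(* A kernel vector of g yields a linear form in the ideal of [T], which has no linear part. *)
have ug : g \in unitmx.
  rewrite -row_free_unit; apply: inj_row_free => v vg0.
  have /alg_pi_eq0[a va] : alg_pi T (linp v) = 0.
    apply: (bij_inj bij_f); rewrite rmorph0 !linear_sum /=.
    transitivity (alg_pi S (\sum_i v 0 i *: linp (r i))).
      by rewrite linear_sum; apply: eq_bigr => i _; rewrite !linearZ /= fX.
    rewrite -[RHS](rmorph0 (alg_pi S)); congr alg_pi.
    under eq_bigr do rewrite scaler_sumr.
    rewrite exchange_big big1 //= => k _.
    under eq_bigr do rewrite scalerA.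
    rewrite -scaler_suml; move/rowP/(_ k): vg0; rewrite !mxE => vg0.
    rewrite -[X in X *: _](_ : 0 = _) ?scale0r // -[LHS]vg0.
    by apply: eq_bigr => i _; rewrite mxE.
  apply/rowP=> k; have [+ _] := coef_on_line_ideal T a (delta_mx k 0).
  by rewrite -va on_line_linp coefMX coefC /= -colE !mxE.
have relg i : exists a, (linp (r i)) ^+ 2
    - \sum_(j < n | (j < i)%N) T i j *: (linp (r j) * linp (r i))
    = \sum_j a j * relator S j.
  have /alg_pi_eq0 /(congr1 f) : in_rel_ideal T (relator T i).
    exists (fun j => (j == i)%:R); rewrite (bigD1 i) //= big1 => [|j /negPf->].
      by rewrite eqxx mul1r addr0.
    by rewrite mul0r.
  rewrite rmorph0 => f0; apply/alg_pi_eq0; rewrite -[RHS]f0 !rmorphB !rmorphXn /= -fX.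
  congr (_ - _); rewrite !raddf_sum /=; apply: eq_bigr => j _.
  by rewrite !linearZ !rmorphM /= !fX.
(* Comparing degree-2 parts along each line turns ideal membership into an identity with constant
   coefficients. *)
have [a ra] := choice relg; pose M := \matrix_(i, j) (a i j).@[fun=> 0].
have gM i x : rel_form T i (g *m x) = \sum_j M i j * rel_form S j x.
  under [RHS]eq_bigr do rewrite mxE.
  have [_ <-] := coef_on_line_ideal S (a i) x; rewrite -ra.
  rewrite rmorphB rmorphXn /= on_line_linp rg (rmorph_sum (on_line x)) /=.
  rewrite exprMn -polyC_exp coefB coefMXn /= coefC /=; congr (_ - _).
  rewrite coef_sum; apply: eq_bigr => j _.
  rewrite on_lineZ rmorphM /= !on_line_linp !rg coefZ; congr (_ * _).
  by rewrite mulrACA -polyCM -expr2 coefMXn /= coefC.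
exists g, M; split=> //; rewrite -row_free_unit; apply: inj_row_free => v vM0.
apply: (@rel_form_free T) => x; rewrite -(mulKVmx ug x).
under eq_bigr do rewrite gM mulr_sumr.
rewrite exchange_big big1 //= => j _.
under eq_bigr do rewrite mulrA.
by rewrite -mulr_suml; move/rowP/(_ j): vM0; rewrite !mxE => ->; rewrite mul0r.
Qed.

Definition quadp (B : 'M[F]_n) : {mpoly F[n]} :=
  \sum_k \sum_l B k l *: ('X_k * 'X_l).

Definition is_quad p := exists B, p = quadp B.

Lemma is_quad_lin c p p' : is_quad p -> is_quad p' -> is_quad (c *: p + p').
Proof.
move=> [B ->] [B' ->]; exists (c *: B + B').
rewrite /quadp scaler_sumr -big_split; apply: eq_bigr => k _ /=.
rewrite scaler_sumr -big_split; apply: eq_bigr => l _ /=.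
by rewrite !mxE scalerDl scalerA.
Qed.

Lemma is_quad0 : is_quad 0.
Proof.
exists 0; rewrite /quadp big1 // => k _; rewrite big1 // => l _.
by rewrite mxE scale0r.
Qed.

Lemma is_quad_sum (I : finType) (P : pred I) (c : I -> F) (G : I -> {mpoly F[n]}) :
  (forall i, is_quad (G i)) -> is_quad (\sum_(i | P i) c i *: G i).
Proof.
by move=> qG; elim/big_rec: _ => [|i p _]; [exact: is_quad0 | exact: is_quad_lin].
Qed.

Lemma is_quadB p p' : is_quad p -> is_quad p' -> is_quad (p - p').
Proof. by move=> qp qp'; rewrite addrC -scaleN1r; apply: is_quad_lin. Qed.

Lemma is_quadM v w : is_quad (linp v * linp w).
Proof.
exists (\matrix_(k, l) (v 0 k * w 0 l)); rewrite mulr_suml; apply: eq_bigr => k _.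
rewrite mulr_sumr; apply: eq_bigr => l _.
by rewrite mxE -scalerAl -scalerAr scalerA.
Qed.

Lemma linp_delta i : linp (delta_mx 0 i) = 'X_i.
Proof.
rewrite /linp (bigD1 i) //= big1 => [|k ki]; rewrite mxE ?eqxx ?scale1r ?addr0 //.
by rewrite (negPf ki) scale0r.
Qed.

Lemma is_quad_relator T i : is_quad (relator T i).
Proof.
apply: is_quadB; first by rewrite expr2 -linp_delta; apply: is_quadM.
by apply: is_quad_sum => j; rewrite -!linp_delta; apply: is_quadM.
Qed.

Lemma meval_quadp B (x : 'cV_n) : (quadp B).@[fun k => x k 0] = (x^T *m B *m x) 0 0.
Proof.
rewrite /quadp mxE rmorph_sum /=; under eq_bigr do rewrite rmorph_sum /=.
rewrite exchange_big; apply: eq_bigr => l _ /=.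
rewrite mxE mulr_suml; apply: eq_bigr => k _.
by rewrite mevalZ mevalM !mevalXU mxE; ring.
Qed.

(* The values of a quadratic form determine it only because 2 != 0. *)
Lemma is_quad_eq0 p :
  is_quad p -> (forall x : 'cV_n, p.@[fun k => x k 0] = 0) -> p = 0.
Proof.
move=> [B ->] B0.
have BT k l : B k l + B l k = 0.
  pose e i : 'cV[F]_n := delta_mx i 0.
  have Be i j : B i j = ((e i)^T *m B *m e j) 0 0.
    by rewrite /e trmx_delta -rowE -colE !mxE.
  have Q (x : 'cV_n) : (x^T *m B *m x) 0 0 = 0 by rewrite -meval_quadp.
  have := Q (e k + e l); rewrite [(_ + _)^T]raddfD !mulmxDl !mulmxDr /=.
  have addE (a b : 'M[F]_1) : (a + b) 0 0 = a 0 0 + b 0 0 by rewrite mxE.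
  by rewrite !addE !Q add0r addr0 -!Be addrC.
have : 2%:R *: quadp B = 0.
  rewrite scaler_nat mulr2n {2}/quadp exchange_big -big_split big1 //= => k _.
  rewrite -big_split big1 //= => l _.
  by rewrite ['X_l * _]mulrC -scalerDl BT scale0r.
by move/eqP; rewrite scaler_eq0 (negPf two_neq0) => /eqP.
Qed.

Definition subst (g : 'M[F]_n) : {mpoly F[n]} -> {mpoly F[n]} :=
  comp_mpoly [tuple linp (row i g) | i < n].
HB.instance Definition _ g := GRing.LRMorphism.on (subst g).

Lemma substX g i : subst g 'X_i = linp (row i g).
Proof. by rewrite /subst comp_mpolyXU -tnth_nth tnth_mktuple. Qed.

Lemma meval_subst g p (x : 'cV_n) :
  (subst g p).@[fun k => x k 0] = p.@[fun k => (g *m x) k 0].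
Proof.
rewrite comp_mpoly_meval; apply: meval_eq => k.
rewrite tnth_mktuple rmorph_sum mxE; apply: eq_bigr => l _.
by rewrite /= mevalZ mevalXU mxE.
Qed.

Lemma subst_linp g v : subst g (linp v) = linp (v *m g).
Proof.
rewrite raddf_sum /=; under eq_bigr do rewrite linearZ /= substX scaler_sumr.
rewrite exchange_big; apply: eq_bigr => l _ /=; rewrite mxE scaler_suml.
by apply: eq_bigr => k _; rewrite mxE scalerA.
Qed.

Lemma substK g h : g *m h = 1%:M -> cancel (subst g) (subst h).
Proof.
move=> gh p; rewrite [in RHS](mpolyE p) [subst g p]comp_mpolyEX raddf_sum.
apply: eq_bigr => m _; rewrite /= linearZ comp_mpolyX rmorph_prod mpolyXE_id /=.
congr (_ *: _); apply: eq_bigr => i _.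
by rewrite rmorphXn /= tnth_mktuple subst_linp -row_mul gh row1 linp_delta.
Qed.

(** Both sides are quadratic polynomials, so agreement of their values is enough. *)
Lemma subst_relator T S g (M : 'M[F]_n) i :
  (forall x, rel_form T i (g *m x) = \sum_j M i j * rel_form S j x) ->
  subst g (relator T i) = \sum_j M i j *: relator S j.
Proof.
move=> gM; apply/eqP; rewrite -subr_eq0; apply/eqP/is_quad_eq0.
  apply: is_quadB; last by apply: is_quad_sum => j; apply: is_quad_relator.
  rewrite rmorphB rmorphXn (rmorph_sum (subst g)) /=; apply: is_quadB.
    by rewrite substX; apply: is_quadM.
  under eq_bigr do rewrite linearZ rmorphM /= !substX.
  by apply: is_quad_sum => j; apply: is_quadM.
have relE U k (x : 'cV_n) : (relator U k).@[fun l => x l 0] = rel_form U k x.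
  rewrite rmorphB rmorphXn (rmorph_sum (meval _)) /= mevalXU; congr (_ - _).
  by apply: eq_bigr => j _; rewrite mevalZ mevalM !mevalXU.
move=> x; rewrite rmorphB /= meval_subst relE gM (rmorph_sum (meval _)) /=; apply/eqP.
by rewrite subr_eq0; apply/eqP/eq_bigr => j _; rewrite mevalZ relE.
Qed.

Lemma subst_ideal T S g (M : 'M[F]_n) p :
  (forall i x, rel_form T i (g *m x) = \sum_j M i j * rel_form S j x) ->
  alg_pi T p = 0 -> alg_pi S (subst g p) = 0.
Proof.
move=> gM /alg_pi_eq0[a ->].
rewrite (rmorph_sum (subst g)) (rmorph_sum (alg_pi S)) big1 //= => i _.
rewrite !rmorphM /= (subst_relator (gM i)) [X in _ * X](_ : _ = 0) ?mulr0 //.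
apply/alg_pi_eq0; exists (fun j => (M i j)%:MP).
by apply: eq_bigr => j _; rewrite mul_mpolyC.
Qed.

Lemma subst_homog g p d :
  (forall m, m \in msupp p -> (2 * mdeg m)%N = d) ->
  forall m, m \in msupp (subst g p) -> (2 * mdeg m)%N = d.
Proof.
move=> dp m; have [->|p0] := eqVneq p 0; first by rewrite raddf0 msupp0.
(* A nonzero [p] has a monomial, so d is even and halving it is exact. *)
have hp : subst g p \is d./2.-homog.
  rewrite /subst comp_mpolyEX big_seq; apply: rpred_sum => k kp; apply: rpredZ.
  have -> : d./2 = (\sum_i k i)%N by rewrite -mdegE -(dp k kp); lia.
  rewrite comp_mpolyX.
  elim/big_rec2: _ => [|i b y _ hy]; first exact: dhomog1.
  apply: dhomogM hy; rewrite -[X in X.-homog]mul1n; apply: dhomogMn.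
  rewrite tnth_mktuple; apply: rpred_sum => j _; apply: rpredZ.
  by rewrite dhomogX /= mdeg1.
move=> /(dhomog_mf hp) ->.
by have := dp _ (mlead_supp p0); lia.
Qed.

Lemma equiv_forms_graded_iso T S :
  equiv_forms (rel_form T) (rel_form S) -> graded_iso T S.
Proof.
move=> [g [M [ug uM gM]]]; have hN := change_formsV ug uM gM.
set h := invmx g in hN.
(* Substitution into a chosen representative; the choice is immaterial because the substitution maps
   ideal into ideal. *)
pose lift U V k (x : alg U) : alg V := alg_pi V (subst k (repr x)).
have liftE U V k (K : 'M[F]_n) :
    (forall i x, rel_form U i (k *m x) = \sum_j K i j * rel_form V j x) ->
    forall p, lift U V k (alg_pi U p) = alg_pi V (subst k p).
  move=> kK p; apply/eqP; rewrite -subr_eq0 -!rmorphB; apply/eqP.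
  by apply: subst_ideal kK _; rewrite rmorphB /= alg_piK subrr.
pose f := lift T S g.
have fE p : f (alg_pi T p) = alg_pi S (subst g p) by apply: liftE gM p.
have fD : zmod_morphism f.
  move=> x y; rewrite -(alg_piK x) -(alg_piK y) -rmorphB !fE.
  by rewrite -rmorphB -rmorphB.
have fM : monoid_morphism f.
  split=> [|x y]; first by rewrite -(alg_pi1 T) fE !rmorph1.
  by rewrite -(alg_piK x) -(alg_piK y) -rmorphM !fE -!rmorphM.
have fZ : scalable f.
  by move=> c x; rewrite -(alg_piK x) -linearZ !fE -!linearZ.
pose fL : {lrmorphism alg T -> alg S} := HB.pack f
  (GRing.isZmodMorphism.Build _ _ f fD) (GRing.isMonoidMorphism.Build _ _ f fM)
  (GRing.isScalable.Build _ _ _ _ f fZ).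
exists fL; split=> [|d x [p [dp ->]]].
  exists (lift S T h) => x /=; rewrite -(alg_piK x).
    by rewrite fE (liftE _ _ _ _ hN) substK // mulmxV.
  by rewrite (liftE _ _ _ _ hN) fE substK // mulVmx.
by exists (subst g p); split; [exact: subst_homog | rewrite /= fE].
Qed.

Lemma graded_isoP T S :
  graded_iso T S <-> equiv_forms (rel_form T) (rel_form S).
Proof.
by split; [exact: graded_iso_equiv_forms | exact: equiv_forms_graded_iso].
Qed.

End GradedIso.

(** * Normal forms in rank 4 *)

Local Notation o0 := (@Ordinal 4 0 isT).
Local Notation o1 := (@Ordinal 4 1 isT).
Local Notation o2 := (@Ordinal 4 2 isT).
Local Notation o3 := (@Ordinal 4 3 isT).

Lemma sum4 (V : nmodType) (f : 'I_4 -> V) :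
  \sum_i f i = f o0 + f o1 + f o2 + f o3.
Proof.
rewrite !big_ord_recl big_ord0 addr0 !addrA.
by do !congr (_ + _); congr f; apply: val_inj.
Qed.

Lemma forall4 (P : 'I_4 -> Prop) : P o0 -> P o1 -> P o2 -> P o3 -> forall i, P i.
Proof.
move=> P0 P1 P2 P3 i.
have E j : val i = val j -> P j -> P i by move=> /val_inj->.
by case: i E => [[|[|[|[|//]]]] lt_i4] E; [apply: (E o0) | apply: (E o1)
                                         | apply: (E o2) | apply: (E o3)].
Qed.

(** Rows may be cut short: an entry that is not listed reads as 0. *)
Definition mx4 (F : fieldType) (rows : seq (seq F)) : 'M[F]_4 :=
  \matrix_(i, j) nth 0 (nth [::] rows i) j.

Lemma det4 (F : fieldType) (A : 'M[F]_4) : \det A =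
    A o0 o0 * (A o1 o1 * (A o2 o2 * A o3 o3 - A o2 o3 * A o3 o2)
             - A o1 o2 * (A o2 o1 * A o3 o3 - A o2 o3 * A o3 o1)
             + A o1 o3 * (A o2 o1 * A o3 o2 - A o2 o2 * A o3 o1))
  - A o0 o1 * (A o1 o0 * (A o2 o2 * A o3 o3 - A o2 o3 * A o3 o2)
             - A o1 o2 * (A o2 o0 * A o3 o3 - A o2 o3 * A o3 o0)
             + A o1 o3 * (A o2 o0 * A o3 o2 - A o2 o2 * A o3 o0))
  + A o0 o2 * (A o1 o0 * (A o2 o1 * A o3 o3 - A o2 o3 * A o3 o1)
             - A o1 o1 * (A o2 o0 * A o3 o3 - A o2 o3 * A o3 o0)
             + A o1 o3 * (A o2 o0 * A o3 o1 - A o2 o1 * A o3 o0))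
  - A o0 o3 * (A o1 o0 * (A o2 o1 * A o3 o2 - A o2 o2 * A o3 o1)
             - A o1 o1 * (A o2 o0 * A o3 o2 - A o2 o2 * A o3 o0)
             + A o1 o2 * (A o2 o0 * A o3 o1 - A o2 o1 * A o3 o0)).
Proof.
(* Indexing entries by naturals lets the lifted ordinals of the nested expansions compute. *)
pose a (i j : nat) := A (inord i) (inord j).
have aE i j : A i j = a i j by rewrite /a !inord_val.
rewrite !aE (expand_det_row _ ord0) !big_ord_recl big_ord0 /cofactor.
rewrite !(expand_det_row _ ord0) !big_ord_recl !big_ord0 /cofactor.
rewrite !(expand_det_row _ ord0) !big_ord_recl !big_ord0 /cofactor.
rewrite !det_mx11 !mxE !aE /= /bump /=.
ring.
Qed.

Section RankFour.
Variable F : fieldType.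
Hypothesis two_neq0 : 2%:R != 0 :> F.

Lemma unitmx_det (A : 'M[F]_4) d : \det A = d -> d != 0 -> A \in unitmx.
Proof. by move=> <-; rewrite unitmxE unitfE. Qed.

Definition normal_forms (c u v w : F) : forms F 4 := fun i x =>
  let: X := fun k => x k 0 in
  nth 0 [:: X o0 ^+ 2; X o1 ^+ 2; X o2 ^+ 2 - c * (X o0 * X o1);
            X o3 ^+ 2 - u * (X o0 * X o1) - v * (X o0 * X o2) - w * (X o1 * X o2)] i.

Local Notation "A ~~ B" := (equiv_forms A B) (at level 70).
Local Notation D := normal_forms.

Local Ltac forms_ring := rewrite !sum4 /D !mxE /= ?sum4 ?mxE /=; ring.

(** The change of variables is diagonal with entries s1, s2, s3, k; the four equations match the
    cross coefficients. *)
Lemma normal_forms_scale (s1 s2 s3 k c u v w c' u' v' w' : F) :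
  s1 != 0 -> s2 != 0 -> s3 != 0 -> k != 0 ->
  c * (s1 * s2) = c' * s3 ^+ 2 -> u * (s1 * s2) = k ^+ 2 * u' ->
  v * (s1 * s3) = k ^+ 2 * v' -> w * (s2 * s3) = k ^+ 2 * w' ->
  D c u v w ~~ D c' u' v' w'.
Proof.
move=> s1n s2n s3n kn ec eu ev ew.
exists (mx4 [:: [:: s1]; [:: 0; s2]; [:: 0; 0; s3]; [:: 0; 0; 0; k]]).
exists (mx4 [:: [:: s1 ^+ 2]; [:: 0; s2 ^+ 2]; [:: 0; 0; s3 ^+ 2];
                [:: 0; 0; 0; k ^+ 2]]).
split; [ apply: (@unitmx_det _ (s1 * s2 * s3 * k)) 
  | apply: (@unitmx_det _ ((s1 * s2 * s3 * k) ^+ 2)) | ].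
- by rewrite det4 !mxE /=; ring.
- by rewrite !mulf_neq0.
- by rewrite det4 !mxE /=; ring.
- by rewrite expf_neq0 // !mulf_neq0.
apply: forall4 => x; rewrite !sum4 /D !mxE /= ?sum4 ?mxE /=; try ring.
  by ring: ec.
transitivity (k ^+ 2 * x o3 0 ^+ 2 - u * (s1 * s2) * (x o0 0 * x o1 0)
  - v * (s1 * s3) * (x o0 0 * x o2 0) - w * (s2 * s3) * (x o1 0 * x o2 0)).
  by ring.
by rewrite eu ev ew; ring.
Qed.

Definition swap12 : 'M[F]_4 :=
  mx4 [:: [:: 0; 1]; [:: 1]; [:: 0; 0; 1]; [:: 0; 0; 0; 1]].

Lemma change_swap12 c u v w :
  change_forms (D c u v w) (D c u w v) swap12 swap12.
Proof.
have uP : swap12 \in unitmx.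
  by apply: (@unitmx_det _ (- 1)); rewrite ?oppr_eq0 ?oner_eq0 // det4 !mxE /=; ring.
by split=> //; apply: forall4 => x; forms_ring.
Qed.

Lemma normal_forms_swap12 c u v w : D c u v w ~~ D c u w v.
Proof. by exists swap12, swap12; apply: change_swap12. Qed.

(** For c = 0 the first three forms are plain squares, so their variables may be permuted freely. *)
Lemma normal_forms_swap13 u v w : D 0 u v w ~~ D 0 w v u.
Proof.
pose P : 'M[F]_4 := mx4 [:: [:: 0; 0; 1]; [:: 0; 1]; [:: 1]; [:: 0; 0; 0; 1]].
have uP : P \in unitmx.
  by apply: (@unitmx_det _ (- 1)); rewrite ?oppr_eq0 ?oner_eq0 // det4 !mxE /=; ring.
by exists P, P; split=> //; apply: forall4 => x; forms_ring.
Qed.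

Lemma normal_forms_swap23 u v w : D 0 u v w ~~ D 0 v u w.
Proof.
pose P : 'M[F]_4 := mx4 [:: [:: 1]; [:: 0; 0; 1]; [:: 0; 1]; [:: 0; 0; 0; 1]].
have uP : P \in unitmx.
  by apply: (@unitmx_det _ (- 1)); rewrite ?oppr_eq0 ?oner_eq0 // det4 !mxE /=; ring.
by exists P, P; split=> //; apply: forall4 => x; forms_ring.
Qed.

(** For v = w = 0 the last two forms have the same shape. *)
Lemma normal_forms_swap34 c u : D c u 0 0 ~~ D u c 0 0.
Proof.
pose P : 'M[F]_4 := mx4 [:: [:: 1]; [:: 0; 1]; [:: 0; 0; 0; 1]; [:: 0; 0; 1]].
have uP : P \in unitmx.
  by apply: (@unitmx_det _ (- 1)); rewrite ?oppr_eq0 ?oner_eq0 // det4 !mxE /=; ring.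
by exists P, P; split=> //; apply: forall4 => x; forms_ring.
Qed.

(* Completing the squares: X_i = Z_i + (half the linear factor of relator i). *)
Lemma rel_form_normal (T : 'M[F]_4) p a3 b3 a b g :
  T o1 o0 = 2%:R * p -> T o2 o1 = 2%:R * b3 -> T o2 o0 + T o2 o1 * p = 2%:R * a3 ->
  T o3 o2 = 2%:R * g -> T o3 o1 + T o3 o2 * b3 = 2%:R * b ->
  T o3 o0 + T o3 o1 * p + T o3 o2 * a3 = 2%:R * a ->
  rel_form T ~~ D (2%:R * a3 * b3) (2%:R * a * b + g ^+ 2 * (2%:R * a3 * b3))
                  (2%:R * a * g) (2%:R * b * g).
Proof.
move=> T10 T21 /(canRL (addrK _)) T20 T32 /(canRL (addrK _)) T31.
move=> /(canRL (addrK _)) /(canRL (addrK _)) T30.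
exists (mx4 [:: [:: 1]; [:: p; 1]; [:: a3; b3; 1]; [:: a; b; g; 1]]).
(* Each relator becomes Z^2 - L^2, with L half its linear factor. The squares in L^2 fill this
   matrix, the cross terms become the coefficients of [D], and trading g^2 Z_3^2 for the third form
   adds g^2 c to u. *)
exists (mx4 [:: [:: 1]; [:: - p ^+ 2; 1]; [:: - a3 ^+ 2; - b3 ^+ 2; 1];
                [:: - a ^+ 2; - b ^+ 2; - g ^+ 2; 1]]).
split; try (apply: (@unitmx_det _ 1); rewrite ?oner_eq0 // det4 !mxE /=; ring).
apply: forall4 => x;
  rewrite /rel_form big_mkcond !sum4 /D !mxE /= ?sum4 ?mxE /=
    ?(T30, T31, T20) ?(T10, T21, T32); ring.
Qed.

End RankFour.

(** * Rigidity of changes of variables between normal forms *)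

Section Isomorphisms.
Variable F : fieldType.
Hypothesis two_neq0 : 2%:R != 0 :> F.

Local Notation "A ~~ B" := (equiv_forms A B) (at level 70).
Local Notation D := (@normal_forms F).

(** Coefficient equations for membership in the span of the normal forms: x3^2 and x4^2 fix the
    multipliers q22 and q33, while the coefficients of x1^2 and x2^2 are free. *)
Definition in_span_eqs (c u v w q01 q02 q12 q22 q03 q13 q23 q33 : F) :=
  [/\ q03 = 0, q13 = 0, q23 = 0
    & [/\ q01 = - c * q22 - u * q33, q02 = - v * q33 & q12 = - w * q33]].

(** Polarization: cross coefficients are read off from values at basis vectors and at sums of two of
    them. *)
Lemma in_span_normal_forms (c u v w q00 q11 q01 q02 q12 q22 q03 q13 q23 q33 : F)
    (m : 'I_4 -> F) :
  (forall x : 'cV_4, q00 * x o0 0 ^+ 2 + q11 * x o1 0 ^+ 2 + q22 * x o2 0 ^+ 2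
     + q33 * x o3 0 ^+ 2 + q01 * (x o0 0 * x o1 0) + q02 * (x o0 0 * x o2 0)
     + q12 * (x o1 0 * x o2 0) + q03 * (x o0 0 * x o3 0)
     + q13 * (x o1 0 * x o3 0) + q23 * (x o2 0 * x o3 0)
     = \sum_j m j * D c u v w j x) ->
  in_span_eqs c u v w q01 q02 q12 q22 q03 q13 q23 q33.
Proof.
move=> H.
pose L x0 x1 x2 x3 := q00 * x0 ^+ 2 + q11 * x1 ^+ 2 + q22 * x2 ^+ 2
     + q33 * x3 ^+ 2 + q01 * (x0 * x1) + q02 * (x0 * x2)
     + q12 * (x1 * x2) + q03 * (x0 * x3) + q13 * (x1 * x3) + q23 * (x2 * x3).
have LE x0 x1 x2 x3 : L x0 x1 x2 x3 = m o0 * x0 ^+ 2 + m o1 * x1 ^+ 2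
    + m o2 * (x2 ^+ 2 - c * (x0 * x1))
    + m o3 * (x3 ^+ 2 - u * (x0 * x1) - v * (x0 * x2) - w * (x1 * x2)).
  have := H (\col_i nth 0 [:: x0; x1; x2; x3] i).
  by rewrite sum4 /normal_forms !mxE /=.
have E03 : q03 = L 1 0 0 1 - L 1 0 0 0 - L 0 0 0 1 by rewrite /L; ring.
have E13 : q13 = L 0 1 0 1 - L 0 1 0 0 - L 0 0 0 1 by rewrite /L; ring.
have E23 : q23 = L 0 0 1 1 - L 0 0 1 0 - L 0 0 0 1 by rewrite /L; ring.
have E01 : q01 = L 1 1 0 0 - L 1 0 0 0 - L 0 1 0 0 by rewrite /L; ring.
have E02 : q02 = L 1 0 1 0 - L 1 0 0 0 - L 0 0 1 0 by rewrite /L; ring.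
have E12 : q12 = L 0 1 1 0 - L 0 1 0 0 - L 0 0 1 0 by rewrite /L; ring.
have E22 : q22 = L 0 0 1 0 by rewrite /L; ring.
have E33 : q33 = L 0 0 0 1 by rewrite /L; ring.
rewrite /in_span_eqs E03 E13 E23 E01 E02 E12 E22 E33 !LE.
by split; [ring | ring | ring | split; ring].
Qed.

(** These say that the linear form with coefficients a0, ..., a3 has square zero in the algebra of
    the normal form. *)
Definition square_eqs c u v w (a0 a1 a2 a3 : F) :=
  in_span_eqs c u v w (2%:R * a0 * a1) (2%:R * a0 * a2) (2%:R * a1 * a2) (a2 ^+ 2)
    (2%:R * a0 * a3) (2%:R * a1 * a3) (2%:R * a2 * a3) (a3 ^+ 2).

Lemma square_eqs_row A c u v w g M i :
  change_forms A (D c u v w) g M -> (forall x, A i x = x i 0 ^+ 2) ->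
  square_eqs c u v w (g i o0) (g i o1) (g i o2) (g i o3).
Proof.
move=> [_ _ gM] Ai.
apply: (@in_span_normal_forms _ _ _ _ (g i o0 ^+ 2) (g i o1 ^+ 2)
          _ _ _ _ _ _ _ _ (M i)) => x.
by rewrite -gM Ai mxE sum4; ring.
Qed.

Lemma mul2_eq0 (a b : F) : 2%:R * a * b = 0 -> a = 0 \/ b = 0.
Proof.
by move/eqP; rewrite !mulf_eq0 (negPf two_neq0) => /orP[]/eqP; [left|right].
Qed.

Lemma mul2_eq0r (a b : F) : b != 0 -> 2%:R * a * b = 0 -> a = 0.
Proof. by move=> /eqP b0 /mul2_eq0[]. Qed.

(** If a3 is nonzero, the other coordinates vanish and then so do u, v, w; once a3 = 0, a nonzero a2
    forces c = 0. What remains is 2 a0 a1 = 0. *)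
Lemma square_zero_nongeneric c u v w a0 a1 a2 a3 : c != 0 ->
  [|| u != 0, v != 0 | w != 0] -> square_eqs c u v w a0 a1 a2 a3 ->
  [/\ a2 = 0, a3 = 0 & a0 = 0 \/ a1 = 0].
Proof.
move=> c0 uvw [E03 E13 E23 [E01 E02 E12]].
have a30 : a3 = 0.
  apply/eqP; apply: contraTT uvw => a3n.
  move: E01 E02 E12; rewrite (mul2_eq0r a3n E03) (mul2_eq0r a3n E13) (mul2_eq0r a3n E23).
  rewrite !(mulr0, mul0r) expr0n /= mulr0 add0r => /esym E01 /esym E02 /esym E12.
  move/eqP: E01; rewrite oppr_eq0 mulf_eq0 expf_eq0 /= (negPf a3n) orbF => ->.
  move/eqP: E02; rewrite mulf_eq0 expf_eq0 /= (negPf a3n) orbF oppr_eq0 => ->.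
  by move/eqP: E12; rewrite mulf_eq0 expf_eq0 /= (negPf a3n) orbF oppr_eq0 => ->.
move: E01 E02 E12; rewrite a30 expr0n /= !mulr0 subr0 => E01 E02 E12.
have a20 : a2 = 0.
  apply/eqP; apply: contraTT isT => a2n.
  move/eqP: E01; rewrite (mul2_eq0r a2n E02) !(mulr0, mul0r) eq_sym.
  by rewrite mulf_eq0 oppr_eq0 expf_eq0 /= (negPf c0) (negPf a2n).
by split=> //; apply: mul2_eq0; rewrite E01 a20 expr0n mulr0.
Qed.

(** The first alternative is a diagonal change of variables; the second also exchanges the third and
    fourth variables. *)
Definition scaling (c u v w c' u' v' w' : F) :=
  exists s1 s2 s3 k, [/\ s1 != 0, s2 != 0, s3 != 0 & k != 0] /\
   ([/\ c * (s1 * s2) = c' * s3 ^+ 2, u * (s1 * s2) = k ^+ 2 * u',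
        v * (s1 * s3) = k ^+ 2 * v' & w * (s2 * s3) = k ^+ 2 * w']
    \/ [/\ c * (s1 * s2) = u' * k ^+ 2, u * (s1 * s2) = c' * s3 ^+ 2,
           v = 0, w = 0 & v' = 0 /\ w' = 0]).

(* When c' and (u', v', w') do not vanish, the target algebra has exactly two
   lines of square-zero elements, and the classes with square in the product of
   these lines are the multiples of Z_3 (and of Z_4 if v' = w' = 0), modulo the
   two lines. This forces g to be monomial. *)
Lemma change_normal_forms_scaling c u v w c' u' v' w' (g M : 'M[F]_4) :
  c' != 0 -> [|| u' != 0, v' != 0 | w' != 0] -> g o0 o0 != 0 ->
  change_forms (D c u v w) (D c' u' v' w') g M ->
  scaling c u v w c' u' v' w'.
Proof.
move=> c'n uvwn g00 chg; have [ug _ gM] := chg.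
have detn : \det g != 0 by rewrite unitmxE unitfE in ug.
set a0 := g o0 o0 in g00.
pose a1 := g o0 o1; pose a2 := g o0 o2; pose a3 := g o0 o3.
pose b0 := g o1 o0; pose b1 := g o1 o1; pose b2 := g o1 o2; pose b3 := g o1 o3.
pose e0 := g o2 o0; pose e1 := g o2 o1; pose e2 := g o2 o2; pose e3 := g o2 o3.
pose f0 := g o3 o0; pose f1 := g o3 o1; pose f2 := g o3 o2; pose f3 := g o3 o3.
have sqA : square_eqs c' u' v' w' a0 a1 a2 a3 by apply: square_eqs_row chg _.
have sqB : square_eqs c' u' v' w' b0 b1 b2 b3 by apply: square_eqs_row chg _.
have [a20 a30 [a00|a10]] := square_zero_nongeneric c'n uvwn sqA.
  by rewrite a00 eqxx in g00.
have [b20 b30 b01] := square_zero_nongeneric c'n uvwn sqB.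
move: detn; rewrite det4 -/a0 -/a1 -/a2 -/a3 -/b0 -/b1 -/b2 -/b3.
rewrite -/e0 -/e1 -/e2 -/e3 -/f0 -/f1 -/f2 -/f3 a10 a20 a30 b20 b30.
case: b01 => [b00|b10] detn; last first.
  by case/eqP: detn; rewrite b10; ring.
(* The first two rows are now multiples of x1 and x2, so the lower right block of g is
   invertible. *)
have {}detn : a0 * b1 * (e2 * f3 - e3 * f2) != 0.
  by apply: contra_neq detn => detn; rewrite b00 -[RHS]detn; ring.
have b1n : b1 != 0 by apply: contra_neq detn => ->; rewrite mulr0 mul0r.
have spE : in_span_eqs c' u' v' w' (2%:R * e0 * e1 - c * (a0 * b1))
   (2%:R * e0 * e2) (2%:R * e1 * e2) (e2 ^+ 2)
   (2%:R * e0 * e3) (2%:R * e1 * e3) (2%:R * e2 * e3) (e3 ^+ 2).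
  apply: (@in_span_normal_forms _ _ _ _ (e0 ^+ 2) (e1 ^+ 2) _ _ _ _ _ _ _ _ (M o2)).
  move=> x; rewrite -gM /normal_forms !mxE !sum4 /= -/a0 -/a1 -/a2 -/a3.
  rewrite -/b0 -/b1 -/b2 -/b3 -/e0 -/e1 -/e2 -/e3 a10 a20 a30 b00 b20 b30; ring.
have spF : in_span_eqs c' u' v' w'
   (2%:R * f0 * f1 - u * (a0 * b1) - v * (a0 * e1) - w * (b1 * e0))
   (2%:R * f0 * f2 - v * (a0 * e2)) (2%:R * f1 * f2 - w * (b1 * e2)) (f2 ^+ 2)
   (2%:R * f0 * f3 - v * (a0 * e3)) (2%:R * f1 * f3 - w * (b1 * e3))
   (2%:R * f2 * f3) (f3 ^+ 2).
  apply: (@in_span_normal_forms _ _ _ _ (f0 ^+ 2 - v * a0 * e0) (f1 ^+ 2 - w * b1 * e1)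
     _ _ _ _ _ _ _ _ (M o3)).
  move=> x; rewrite -gM /normal_forms !mxE !sum4 /= -/a0 -/a1 -/a2 -/a3.
  rewrite -/b0 -/b1 -/b2 -/b3 -/e0 -/e1 -/e2 -/e3 -/f0 -/f1 -/f2 -/f3.
  by rewrite a10 a20 a30 b00 b20 b30; ring.
move: spE spF => [E03 E13 E23 [E01 E02 E12]] [F03 F13 F23 [F01 F02 F12]].
(* If e3 = 0 the equations make g diagonal. Otherwise the third row is a multiple of x4 and the
   fourth one of x3, which forces v, w, v' and w' to vanish. *)
have [e30|e3n] := eqVneq e3 0.
  move: detn; rewrite e30 mul0r subr0 !mulf_eq0 !negb_or => /and3P[_ e2n f3n].
  move: E01 E02 E12 F03 F13 F23 F01 F02 F12.
  rewrite e30 expr0n /= !mulr0 !subr0.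
  move=> E01 /(mul2_eq0r e2n) e00 /(mul2_eq0r e2n) e10.
  move=> /(mul2_eq0r f3n) f00 /(mul2_eq0r f3n) f10 /(mul2_eq0r f3n) f20.
  move: E01; rewrite e00 e10 f00 f10 f20 expr0n /= !(mulr0, mul0r, subr0, add0r).
  rewrite !mulNr => /oppr_inj E01 /oppr_inj F01 /oppr_inj F02 /oppr_inj F12.
  exists a0, b1, e2, f3; split=> //; left.
  by split; rewrite ?E01 ?F01 ?F02 ?F12 // mulrC.
move: E01 E02 E12.
rewrite (mul2_eq0r e3n E03) (mul2_eq0r e3n E13) (mul2_eq0r e3n E23).
rewrite expr0n /= !(mulr0, mul0r, sub0r) !mulNr => /oppr_inj E01 /esym/eqP.
rewrite oppr_eq0 mulf_eq0 expf_eq0 /= (negPf e3n) orbF => /eqP v'0 /esym/eqP.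
rewrite oppr_eq0 mulf_eq0 expf_eq0 /= (negPf e3n) orbF => /eqP w'0.
have f2n : f2 != 0.
  by apply: contra_neq detn => ->; rewrite (mul2_eq0r e3n E23); ring.
have f30 : f3 = 0 by case: (mul2_eq0 F23) => // /eqP; rewrite (negPf f2n).
move: F01 F02 F12 F03 F13; rewrite v'0 w'0 f30 (mul2_eq0r e3n E23).
rewrite (mul2_eq0r e3n E03) (mul2_eq0r e3n E13) expr0n /= !(mulr0, mul0r, subr0, oppr0).
move=> F01 /(mul2_eq0r f2n) f00 /(mul2_eq0r f2n) f10 F03 F13.
move: F01 F03 F13; rewrite f00 f10 !(mulr0, mul0r, sub0r, mulNr).
move=> /oppr_inj F01 /eqP; rewrite oppr_eq0 !mulf_eq0 (negPf g00) (negPf e3n) !orbF.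
move=> /eqP v0 /eqP; rewrite oppr_eq0 !mulf_eq0 (negPf b1n) (negPf e3n) !orbF => /eqP w0.
by exists a0, b1, f2, e3; split=> //; right.
Qed.

(** The first row of g lies on one of the two square-zero lines; if it is the second line, composing
    with [swap12] brings it to the first. *)
Lemma equiv_normal_forms_scaling c u v w c' u' v' w' :
  c' != 0 -> [|| u' != 0, v' != 0 | w' != 0] ->
  D c u v w ~~ D c' u' v' w' ->
  scaling c u v w c' u' v' w' \/ scaling c u v w c' u' w' v'.
Proof.
move=> c'n uvwn [g [M gM]]; have [ug _ _] := gM.
have [g00|g00n] := eqVneq (g o0 o0) 0; last first.
  by left; apply: change_normal_forms_scaling gM.
have gM' := change_formsM gM (change_swap12 c' u' v' w').
right; apply: change_normal_forms_scaling gM' => //.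
  by rewrite [X in _ || X]orbC.
have sqA : square_eqs c' u' v' w' (g o0 o0) (g o0 o1) (g o0 o2) (g o0 o3).
  by apply: square_eqs_row gM _.
have [g02 g03 _] := square_zero_nongeneric c'n uvwn sqA.
rewrite mxE sum4 !mxE /= !mulr0 add0r mulr1 !addr0.
apply: contraTneq ug => g01; rewrite unitmxE unitfE det4 g00 g01 g02 g03 negbK.
by apply/eqP; ring.
Qed.
End Isomorphisms.

(** * Matrices realizing the normal forms, and the degenerate classes *)

Section NormalForms.
Variable F : fieldType.
Hypothesis two_neq0 : 2%:R != 0 :> F.

Local Notation "A ~~ B" := (equiv_forms A B) (at level 70).
Local Notation D := (@normal_forms F).

(* After completing the squares, the last two relations become
   Z_3 ^+ 2 = c Z_1 Z_2 and Z_4 ^+ 2 = (a Z_1 + b Z_2 + g Z_3) ^+ 2. *)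
Definition tower (a b g c : F) : 'M[F]_4 :=
  mx4 [:: [::]; [::]; [:: c; 2%:R]; [:: 2%:R * a - g * c; 2%:R * b - 2%:R * g; 2%:R * g]].

Lemma tower_strictly_lower a b g c : strictly_lower (tower a b g c).
Proof.
by apply/forallP; apply: forall4; apply/forallP; apply: forall4; rewrite mxE /= ?eqxx.
Qed.

Lemma rel_form_tower a b g c :
  rel_form (tower a b g c)
    ~~ D c (2%:R * a * b + g ^+ 2 * c) (2%:R * a * g) (2%:R * b * g).
Proof.
have cE : 2%:R * (c / 2%:R) = c by rewrite mulrC divfK.
(* Taking p = 0, a3 = c/2 and b3 = 1 makes 2 a3 b3 equal to c. *)
have := @rel_form_normal _ (tower a b g c) 0 (c / 2%:R) 1 a b g.
by rewrite !mulr1 cE; apply; rewrite !mxE /= ?cE; ring: cE.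
Qed.

Lemma rel_form_ex T : exists a b g c,
  rel_form T ~~ D c (2%:R * a * b + g ^+ 2 * c) (2%:R * a * g) (2%:R * b * g).
Proof.
have half x : exists y, x = 2%:R * y :> F.
  by exists (x / 2%:R); rewrite mulrC divfK.
have [p Tp] := half (T o1 o0); have [b3 Tb3] := half (T o2 o1).
have [a3 Ta3] := half (T o2 o0 + T o2 o1 * p); have [g Tg] := half (T o3 o2).
have [b Tb] := half (T o3 o1 + T o3 o2 * b3).
have [a Ta] := half (T o3 o0 + T o3 o1 * p + T o3 o2 * a3).
by exists a, b, g, (2%:R * a3 * b3); apply: rel_form_normal Ta.
Qed.

(** A nonzero a3 would force a0 = 0, whereas the x1 x2 coefficient then requires 2 a3^2 = 0. *)
Lemma square_zero_222 (a0 a1 a2 a3 : F) : square_eqs 0 2%:R 2%:R 2%:R a0 a1 a2 a3 ->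
  [/\ a3 = 0, a0 = 0 \/ a1 = 0, a0 = 0 \/ a2 = 0 & a1 = 0 \/ a2 = 0].
Proof.
move=> [E03 E13 E23 [E01 E02 E12]].
have a30 : a3 = 0.
  apply/eqP; apply: contraTT isT => a3n.
  move/eqP: E01; rewrite (mul2_eq0r two_neq0 a3n E03) !(mulr0, mul0r, oppr0, sub0r).
  by rewrite eq_sym oppr_eq0 mulf_eq0 (negPf two_neq0) expf_eq0 (negPf a3n).
move: E01 E02 E12; rewrite a30 expr0n /= !(mulr0, mul0r, oppr0, sub0r).
by move=> /(mul2_eq0 two_neq0) ? /(mul2_eq0 two_neq0) ? /(mul2_eq0 two_neq0) ?.
Qed.

(** All four source variables have square zero, so the last column of g would vanish. *)
Lemma not_0000_0222 : ~ D 0 0 0 0 ~~ D 0 2%:R 2%:R 2%:R.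
Proof.
move=> [g [M gM]]; have [+ _ _] := gM.
have g3 : forall i, g i o3 = 0.
  have sq i : (forall x, D 0 0 0 0 i x = x i 0 ^+ 2) -> g i o3 = 0.
    by move=> sqi; have [] := square_zero_222 (square_eqs_row gM sqi).
  by apply: forall4; apply: sq => x; rewrite /normal_forms /=; ring.
by rewrite unitmxE unitfE det4 !g3 => /eqP; case; ring.
Qed.

(** Square-zero elements of the target have no x3 coordinate, so the third column of g would
    vanish. *)
Lemma not_0000_1000 : ~ D 0 0 0 0 ~~ D 1 0 0 0.
Proof.
move=> [g [M gM]]; have [+ _ _] := gM.
have row2 (a0 a1 a2 a3 : F) : square_eqs 1 0 0 0 a0 a1 a2 a3 -> a2 = 0.
  move=> [_ _ _ [+ + _]] => E01 E02.
  apply/eqP; apply: contraTT isT => a2n; move/eqP: E01.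
  rewrite (mul2_eq0r two_neq0 a2n (a := a0)) ?E02 ?oppr0 ?mul0r //.
  by rewrite mulr0 mul0r subr0 eq_sym mulf_eq0 oppr_eq0 oner_eq0 expf_eq0 (negPf a2n).
have g2 : forall i, g i o2 = 0.
  by apply: forall4; apply: (row2 _ _ _ _ (square_eqs_row gM _)) => // x;
    rewrite /normal_forms /=; ring.
by rewrite unitmxE unitfE det4 !g2 => /eqP; case; ring.
Qed.

(** Only the third row of g can involve x4. Its relator then needs the product of the first two rows
    to have all three cross terms in x1, x2, x3, but the first row is a multiple of a single
    variable. *)
Lemma not_1000_0222 : ~ D 1 0 0 0 ~~ D 0 2%:R 2%:R 2%:R.
Proof.
move=> [g [M gM]]; have [ug _ sM] := gM.
have [a3 a01 a02 a12] : [/\ g o0 o3 = 0, g o0 o0 = 0 \/ g o0 o1 = 0,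
    g o0 o0 = 0 \/ g o0 o2 = 0 & g o0 o1 = 0 \/ g o0 o2 = 0].
  by apply: square_zero_222; apply: square_eqs_row gM _.
have [b3 b01 b02 b12] : [/\ g o1 o3 = 0, g o1 o0 = 0 \/ g o1 o1 = 0,
    g o1 o0 = 0 \/ g o1 o2 = 0 & g o1 o1 = 0 \/ g o1 o2 = 0].
  by apply: square_zero_222; apply: square_eqs_row gM _.
have [f3 _ _ _] : [/\ g o3 o3 = 0, g o3 o0 = 0 \/ g o3 o1 = 0,
    g o3 o0 = 0 \/ g o3 o2 = 0 & g o3 o1 = 0 \/ g o3 o2 = 0].
  apply: square_zero_222; apply: square_eqs_row gM _ => x.
  by rewrite /normal_forms /=; ring.
have e3n : g o2 o3 != 0.
  apply: contraTneq ug => e3; rewrite unitmxE unitfE det4 a3 b3 e3 f3 negbK.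
  by apply/eqP; ring.
pose q i j := 2%:R * g o2 i * g o2 j - (g o0 i * g o1 j + g o0 j * g o1 i).
have : in_span_eqs 0 2%:R 2%:R 2%:R (q o0 o1) (q o0 o2) (q o1 o2)
    (g o2 o2 ^+ 2 - g o0 o2 * g o1 o2) (q o0 o3) (q o1 o3) (q o2 o3) (g o2 o3 ^+ 2).
  apply: (@in_span_normal_forms _ _ _ _ _ (g o2 o0 ^+ 2 - g o0 o0 * g o1 o0)
     (g o2 o1 ^+ 2 - g o0 o1 * g o1 o1) _ _ _ _ _ _ _ _ (M o2)) => x.
  by rewrite -sM /normal_forms !mxE !sum4 /= /q a3 b3; ring.
rewrite /q a3 b3 !(mulr0, mul0r, addr0, subr0, oppr0, sub0r).
move=> [/(mul2_eq0r two_neq0 e3n)-> /(mul2_eq0r two_neq0 e3n)->].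
move=> /(mul2_eq0r two_neq0 e3n)->; rewrite !(mulr0, mul0r, oppr0, sub0r, mulNr).
move=> [/oppr_inj E01 /oppr_inj E02 /oppr_inj E12].
have e3n2 : 2%:R * g o2 o3 ^+ 2 != 0 by rewrite mulf_neq0 // expf_neq0.
have [a0|a0] := eqVneq (g o0 o0) 0.
  case: a12 => a1.
    by move/esym/eqP: E01; rewrite a0 a1 !mul0r addr0 (negPf e3n2).
  by move/esym/eqP: E02; rewrite a0 a1 !mul0r addr0 (negPf e3n2).
case: a01 => [/eqP|a1]; first by rewrite (negPf a0).
case: a02 => [/eqP|a2]; first by rewrite (negPf a0).
by move/esym/eqP: E12; rewrite a1 a2 !mul0r addr0 (negPf e3n2).
Qed.

End NormalForms.

(** * Counting classes over a finite field *)

Section Counting.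

(** Sending l to the class of [f l] is a bijection from S onto the classes. *)
Lemma card_equivalence_partition (T L : finType) (R : rel T) (A : {set T})
    (S : {set L}) (f : L -> T) :
  reflexive R -> ssrbool.symmetric R -> transitive R ->
  {in S, forall l, f l \in A} -> {in A, forall x, exists2 l, l \in S & R x (f l)} ->
  {in S &, forall l l', R (f l) (f l') -> l = l'} ->
  #|equivalence_partition R A| = #|S|.
Proof.
move=> Rrefl Rsym Rtrans fA Rf f_inj.
pose C x := [set y in A | R x y].
have C_inj : {in S &, injective (fun l => C (f l))}.
  move=> l l' lS l'S /setP/(_ (f l')); rewrite !inE fA // Rrefl /= => Rff.
  by apply: f_inj => //; rewrite Rff.
rewrite -(card_in_imset C_inj); apply: eq_card => B.
apply/imsetP/imsetP=> [[x xA ->]|[l lS ->]]; last by exists (f l); rewrite ?fA.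
have [l lS Rxl] := Rf x xA; exists l => //; apply/setP=> y; rewrite !inE.
congr (_ && _); apply/idP/idP; last exact: Rtrans.
by apply: Rtrans; rewrite Rsym.
Qed.

(** The enumeration rank selects one element per orbit. Reversing the inequality gives the image of
    this set under f; the two sets cover A and meet in the fixed points. *)
Lemma card_involution (T : finType) (A : {set T}) (f : T -> T) :
  {in A, forall x, f x \in A} -> {in A, forall x, f (f x) = x} ->
  (2 * #|[set x in A | (enum_rank x <= enum_rank (f x))%N]|)%N
    = (#|A| + #|[set x in A | f x == x]|)%N.
Proof.
move=> fA fK.
set H := [set x in A | _]; pose H' := [set x in A | (enum_rank (f x) <= enum_rank x)%N].
have card_H' : #|H'| = #|H|.
  have f_inj : {in H &, injective f}.
    by move=> x y /setIdP[xA _] /setIdP[yA _] /(congr1 f); rewrite !fK.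
  rewrite -(card_in_imset f_inj); apply: eq_card => x; apply/idP/imsetP.
    move=> /setIdP[xA le_fx]; exists (f x); rewrite ?fK //.
    by rewrite inE fA // fK.
  by move=> [y /setIdP[yA le_y] ->]; rewrite inE fA // fK.
rewrite mul2n -addnn -{2}card_H' -cardsUI; congr (_ + _)%N; apply: eq_card => x.
  by rewrite !inE -andb_orr leq_total andbT.
rewrite !inE andbACA andbb -eqn_leq (inj_eq (@ord_inj _)).
by rewrite (inj_eq enum_rank_inj) eq_sym.
Qed.

Variable F : finFieldType.
Hypothesis two_neq0 : 2%:R != 0 :> F.

Definition is_square (x : F) := [exists t, x == t ^+ 2].

Lemma is_squareP x : reflect (exists t, x = t ^+ 2) (is_square x).
Proof. by apply: (iffP existsP) => -[t /eqP]; exists t => //; apply/eqP. Qed.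

Definition nzsquares := [set x | (x != 0) && is_square x].

Lemma card_nonzero : #|[set x : F | x != 0]| = #|F|.-1.
Proof.
rewrite -(cardsC1 (0 : F)); apply: eq_card => x; by rewrite !inE.
Qed.

(** Negation has no nonzero fixed point, and squaring is injective on representatives of pairs of
    opposites. *)
Lemma card_nzsquares : (2 * #|nzsquares|)%N = #|F|.-1.
Proof.
pose U := [set x : F | x != 0]; have UN : {in U, forall x, - x \in U}.
  by move=> x; rewrite !inE oppr_eq0.
have := card_involution UN (fun x _ => opprK x).
rewrite -card_nonzero [X in _ = (_ + X)%N](_ : _ = 0%N) ?addn0 => [<-|]; last first.
  apply/eqP; rewrite cards_eq0; apply/eqP/setP=> x; rewrite !inE.
  apply/negP=> /andP[x0]; rewrite eq_sym -addr_eq0 -mulr2n -mulr_natl.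
  by rewrite mulf_eq0 (negPf two_neq0) (negPf x0).
set H := [set x in U | _].
have sq_inj : {in H &, injective (fun x : F => x ^+ 2)}.
  move=> x y /setIdP[_ le_x] /setIdP[_ le_y] /eqP.
  rewrite eqf_sqr => /orP[/eqP//|/eqP xy]; move: le_x; rewrite {}xy opprK in le_y *.
  by move=> le_x; apply/enum_rank_inj/val_inj/eqP; rewrite eqn_leq le_x le_y.
rewrite -(card_in_imset sq_inj); congr (2 * _)%N; apply: eq_card => x.
apply/setIdP/imsetP=> [[x0 /is_squareP[t xt]]|[t /setIdP[t0 _] ->]]; last first.
  move: t0; rewrite inE => t0.
  by split; [exact: expf_neq0 | apply/is_squareP; exists t].
have t0 : t != 0 by apply: contraNneq x0 => t0; rewrite xt t0 expr0n.
have [le_t|/ltnW le_t] := leqP (enum_rank t) (enum_rank (- t)).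
  by exists t; rewrite // !inE t0.
by exists (- t); rewrite ?sqrrN // !inE oppr_eq0 t0 opprK.
Qed.

(** Otherwise q - 1 would equal its own half. *)
Lemma nonsquare_ex : exists d : F, ~~ is_square d.
Proof.
have F_gt1 : (1 < #|F|)%N.
  by rewrite -cardsT (cardsD1 0) inE (cardsD1 1) !inE oner_eq0.
apply/existsP; apply: contraTT F_gt1; rewrite negb_exists => /forallP all_sq.
have := card_nzsquares; rewrite (_ : #|nzsquares| = #|F|.-1); first lia.
rewrite -card_nonzero; apply: eq_card => x; rewrite !inE.
by have := all_sq x; rewrite negbK => ->; rewrite andbT.
Qed.

(** Multiplication by d sends nonzero squares injectively to nonsquares, and both sets have the same
    size. *)
Lemma nonsquare_coset d x : ~~ is_square d ->
  exists t, x = t ^+ 2 \/ x = d * t ^+ 2.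
Proof.
move=> nsd; have [->|x0] := eqVneq x 0; first by exists 0; rewrite expr0n; left.
have [/is_squareP[t]|nsx] := boolP (is_square x); first by exists t; left.
have d0 : d != 0.
  by apply: contraNneq nsd => ->; apply/is_squareP; exists 0; rewrite expr0n.
pose N := [set y : F | y != 0] :\: nzsquares.
have cardN : #|N| = #|nzsquares|.
  rewrite cardsD (setIidPr _); last by apply/subsetP=> y /setIdP[]; rewrite inE.
  by rewrite card_nonzero -card_nzsquares mul2n -addnn addnK.
have dN : [set d * y | y in nzsquares] = N.
  apply/eqP; rewrite eqEcard card_imset ?cardN ?leqnn ?andbT; last exact: mulfI.
  apply/subsetP=> _ /imsetP[y /setIdP[y0 /is_squareP[t yt]] ->].
  rewrite !inE mulf_neq0 //= andbT; apply: contra nsd => /is_squareP[s ds].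
  apply/is_squareP; exists (s / t); rewrite exprMn exprVn -ds yt mulfK //.
  by rewrite -yt.
have : x \in N by rewrite !inE x0 nsx.
rewrite -dN => /imsetP[y /setIdP[_ /is_squareP[t ->]] ->].
by exists t; right.
Qed.

(* Transversal of the identification of a square with its inverse. *)
Definition inverse_reps :=
  [set e : F | (e != 0) && (is_square e ==> (enum_rank e <= enum_rank e^-1)%N)].

Lemma is_squareV x : is_square x^-1 = is_square x.
Proof.
have sqV y : is_square y -> is_square y^-1.
  by move=> /is_squareP[t ->]; apply/is_squareP; exists t^-1; rewrite exprVn.
by apply/idP/idP=> /sqV; rewrite ?invrK.
Qed.

Lemma card_inverse_reps :
  (#|F| = 3 %[mod 4] -> 4 * #|inverse_reps| = 3 * #|F| - 1)%N /\
  (#|F| = 1 %[mod 4] -> 4 * #|inverse_reps| = 3 * #|F| + 1)%N.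
Proof.
pose N := [set e : F | (e != 0) && ~~ is_square e].
have cardN : (#|nzsquares| + #|N|)%N = #|F|.-1.
  rewrite -card_nonzero -(cardsID [set x | is_square x] [set x : F | x != 0]).
  by congr (_ + _)%N; apply: eq_card => x; rewrite !inE // andbC.
have sqV : {in nzsquares, forall x, x^-1 \in nzsquares}.
  by move=> x; rewrite !inE invr_eq0 is_squareV.
have := card_involution sqV (fun x _ => invrK x).
set H := [set x in nzsquares | _]; set fixV := [set x in _ | _].
have cardR : #|inverse_reps| = (#|N| + #|H|)%N.
  rewrite -(cardsID [set x | ~~ is_square x] inverse_reps).
  by congr (_ + _)%N; apply: eq_card => x; rewrite !inE; case: is_square;
    rewrite //= ?andbT ?andbF.
have fix1 : (0 < #|fixV|)%N.
  apply/card_gt0P; exists 1; rewrite !inE invr1 oner_eq0 eqxx andbT /=.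
  by apply/is_squareP; exists 1; rewrite expr1n.
have fix2 : (#|fixV| <= 2)%N.
  rewrite -(_ : #|[set (1 : F); - 1]| = 2%N); last first.
    by rewrite cards2 eq_sym -subr_eq0 -opprD oppr_eq0 two_neq0.
  apply/subset_leq_card/subsetP=> x; rewrite !inE => /andP[/andP[x0 _] /eqP xV].
  by rewrite -eqf_sqr expr1n expr2 -{1}xV mulVf.
have F_gt1 : (1 < #|F|)%N.
  by rewrite -cardsT (cardsD1 0) inE (cardsD1 1) !inE oner_eq0.
(* With s = (q - 1)/2 and f = 1 or 2 fixed points, the transversal has s + (s + f)/2 elements, and f
   has the parity of s. *)
have := card_nzsquares; rewrite cardR; lia.
Qed.

End Counting.

(** * The list of classes in rank 4 *)

Section Classification.
Variable F : finFieldType.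
Hypothesis two_neq0 : 2%:R != 0 :> F.
Variable d : F.
Hypothesis nonsquare_d : ~~ is_square d.

Local Notation "A ~~ B" := (equiv_forms A B) (at level 70).
Local Notation D := (@normal_forms F).
Local Notation label := ('I_6 + F)%type.

(** Labels 0, 1, 3, 4 cover v = w = 0; label 2 is c = 0 with a, b, g nonzero; label 5 has c, g and
    exactly one of a, b nonzero. When all are nonzero, e = g^2 c / (2ab); at e = 0 the family would
    repeat label 2. *)
Definition label_forms (l : label) : forms F 4 :=
  match l with
  | inl i => nth (D 0 0 0 0) [:: D 0 0 0 0; D 1 0 0 0; D 0 2%:R 2%:R 2%:R;
                                 D 1 1 0 0; D 1 d 0 0; D 1 1 0 2%:R] i
  | inr e => D (2%:R * e) (2%:R + 2%:R * e) 2%:R 2%:R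
  end.

Definition label_tower (l : label) : 'M[F]_4 :=
  match l with
  | inl i => nth (tower 0 0 0 0) [:: tower 0 0 0 0; tower 0 0 0 1; tower 1 1 1 0;
       tower 0 0 1 1; tower (d / 2%:R) 1 0 1; tower 0 1 1 1] i
  | inr e => tower 1 1 1 (2%:R * e)
  end.

Lemma label_tower_lower l : strictly_lower (label_tower l).
Proof.
case: l => [[[|[|[|[|[|[|//]]]]]] lt_i]|e] /=; exact: tower_strictly_lower.
Qed.

Lemma rel_form_label_tower l : rel_form (label_tower l) ~~ label_forms l.
Proof.
have tow c u v w a b g : c = c -> 2%:R * a * b + g ^+ 2 * c = u -> 2%:R * a * g = v ->
    2%:R * b * g = w -> rel_form (tower a b g c) ~~ D c u v w.
  by move=> _ <- <- <-; apply: rel_form_tower.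
have dE : 2%:R * (d / 2%:R) = d by rewrite mulrC divfK.
by case: l => [[[|[|[|[|[|[|//]]]]]] lt_i]|e] /=; apply: tow => //; ring: dE.
Qed.

(** If c and u are both nonzero, only the class of u/c modulo squares survives rescaling; a single
    nonzero parameter can be moved to c and made 1. *)
Lemma normal_forms_cu00 c u : exists i : 'I_6, D c u 0 0 ~~ label_forms (inl i).
Proof.
have one_param x : exists i : 'I_6, D x 0 0 0 ~~ label_forms (inl i).
  have [->|x0] := eqVneq x 0.
    by exists (inord 0); rewrite /= inordK //; apply: equiv_forms_refl.
  exists (inord 1); rewrite /= inordK //=.
  apply: (@normal_forms_scale _ x^-1 1 1 1);
    by rewrite ?invr_eq0 ?oner_eq0 // ?expr1n ?mulr1 ?mulfV ?mul0r ?mulr0.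
have [->|u0] := eqVneq u 0; first exact: one_param.
have [->|c0] := eqVneq c 0.
  have [i ui] := one_param u; exists i.
  exact: equiv_forms_trans (normal_forms_swap34 _ _) ui.
have uc0 : u / c != 0 by rewrite mulf_neq0 ?invr_eq0.
have [t ut] := nonsquare_coset two_neq0 (u / c) nonsquare_d.
have t0 : t != 0.
  by apply: contraNneq uc0 => t0; case: ut => ->; rewrite t0 expr0n /= ?mulr0 eqxx.
case: ut => ut; [exists (inord 3) | exists (inord 4)]; rewrite /= inordK //=;
  apply: (@normal_forms_scale _ c^-1 1 1 t);
  by rewrite ?invr_eq0 ?oner_eq0 // ?expr1n ?mulr1 ?ut ?mulfV ?mul0r ?mulr0 // mulrC.
Qed.

Lemma normal_forms_cu0w c b g : c != 0 -> g != 0 -> b != 0 ->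
  D c (g ^+ 2 * c) 0 (2%:R * b * g) ~~ D 1 1 0 2%:R.
Proof.
move=> c0 g0 b0.
(* With s3 = 1 and k = g, the equation for w gives s2 and that for c gives s1; the one for u then
   holds as well. *)
apply: (@normal_forms_scale _ (b / (c * g)) (g / b) 1 g); rewrite ?oner_eq0 //.
- by rewrite !mulf_neq0 ?invr_eq0 ?mulf_neq0.
- by rewrite mulf_neq0 ?invr_eq0.
- by field; rewrite c0 g0 b0.
- by field; rewrite c0 g0 b0.
- by rewrite mul0r mulr0.
- by field; rewrite b0.
Qed.

Lemma label_exists a b g c : exists2 l : label,
  (if l is inr e then e != 0 else true)
  & D c (2%:R * a * b + g ^+ 2 * c) (2%:R * a * g) (2%:R * b * g) ~~ label_forms l.
Proof.
have two_params c0 u v w : (exists c' u', D c0 u v w ~~ D c' u' 0 0) ->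
    exists2 l : label, (if l is inr e then e != 0 else true)
    & D c0 u v w ~~ label_forms l.
  move=> [c' [u' eqD]]; have [i eqi] := normal_forms_cu00 c' u'.
  by exists (inl i) => //; apply: equiv_forms_trans eqD eqi.
have [->|g0] := eqVneq g 0.
  rewrite expr0n !(mulr0, mul0r); apply: two_params.
  by do 2!eexists; apply: equiv_forms_refl.
have [->|c0] := eqVneq c 0.
  rewrite mulr0 addr0.
  have [->|a0] := eqVneq a 0.
    rewrite !(mulr0, mul0r).
    apply: two_params; do 2!eexists; exact: normal_forms_swap13.
  have [->|b0] := eqVneq b 0.
    rewrite !(mulr0, mul0r).
    apply: two_params; do 2!eexists; exact: normal_forms_swap23.
  exists (inl (inord 2)); rewrite //= inordK //=.
  apply: (@normal_forms_scale _ a^-1 b^-1 g^-1 1);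
    rewrite ?invr_eq0 ?oner_eq0 //; field; by rewrite ?a0 ?b0 ?g0.
have [->|a0] := eqVneq a 0.
  rewrite !(mulr0, mul0r, add0r); have [->|b0] := eqVneq b 0.
    rewrite !(mulr0, mul0r); apply: two_params.
    by do 2!eexists; apply: equiv_forms_refl.
  exists (inl (inord 5)); rewrite //= inordK //=; exact: normal_forms_cu0w.
have [->|b0] := eqVneq b 0.
  rewrite !(mulr0, mul0r, add0r).
  exists (inl (inord 5)); rewrite //= inordK //=.
  apply: equiv_forms_trans (normal_forms_swap12 _ _ _ _) _.
  exact: normal_forms_cu0w.
exists (inr (g ^+ 2 * c / (2%:R * a * b))).
  by rewrite !mulf_neq0 ?invr_eq0 ?mulf_neq0 ?expf_neq0.
(* This scaling makes v = w = 2, turns c into g^2 c / (ab) = 2e and u into 2 + 2e. *)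
apply: (@normal_forms_scale _ a^-1 b^-1 g^-1 1);
  rewrite ?invr_eq0 ?oner_eq0 //; field; by rewrite ?a0 ?b0 ?g0 ?two_neq0.
Qed.

(** Since v = w = 2 on both sides, k^2 = s1 s3; writing e = t^2 supplies the root k = 1/t for s1 =
    s2 = t^-2 and s3 = 1. *)
Lemma family_inverse e : e != 0 -> is_square e ->
  label_forms (inr e) ~~ label_forms (inr e^-1).
Proof.
move=> e0 /is_squareP[t et]; have t0 : t != 0.
  by apply: contraNneq e0 => t0; rewrite et t0 expr0n.
rewrite /= et; apply: (@normal_forms_scale _ (t ^- 2) (t ^- 2) 1 t^-1);
  rewrite ?invr_eq0 ?expf_neq0 ?oner_eq0 //; field; by rewrite t0.
Qed.

(** The equations for v and w give s1 = s2 and k^2 = s1 s3. Eliminating e' factors the rest: s1 = s3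
    means e' = e, while s3 = e s1 means e' = 1/e and e = (s3/k)^2. *)
Lemma family_scaling e e' : e != 0 -> e' != 0 ->
  label_forms (inr e) ~~ label_forms (inr e') ->
  e = e' \/ is_square e /\ e' = e^-1.
Proof.
move=> e0 e'0 eqee.
have [] : scaling (2%:R * e) (2%:R + 2%:R * e) 2%:R 2%:R
                  (2%:R * e') (2%:R + 2%:R * e') 2%:R 2%:R.
  have := equiv_normal_forms_scaling two_neq0 _ _ eqee.
  by rewrite mulf_neq0 // two_neq0 !orbT => /(_ isT isT)[].
move=> s1 [s2 [s3 [k [[s1n s2n s3n kn] [[]|[]]]]]]; last first.
  by move=> _ _ /eqP; rewrite (negPf two_neq0).
move=> H1 H2 H3 H4.
have E3 : s1 * s3 = k ^+ 2 by apply: (mulfI two_neq0); rewrite H3 mulrC.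
have s12 : s2 = s1.
  by apply: (mulIf s3n); rewrite E3; apply: (mulfI two_neq0); rewrite H4 mulrC.
rewrite {}s12 in H1 H2.
have E1 : e * s1 ^+ 2 = e' * s3 ^+ 2.
  apply: (mulfI two_neq0); transitivity (2%:R * e * (s1 * s1)); first by ring.
  by rewrite H1; ring.
have E2 : (1 + e) * s1 = s3 * (1 + e').
  apply: (mulfI s1n); apply: (mulfI two_neq0).
  transitivity ((2%:R + 2%:R * e) * (s1 * s1)); first by ring.
  by rewrite H2 -E3; ring.
have : (s1 - s3) * (e * s1 - s3) = 0.
  transitivity (e * s1 ^+ 2 - (1 + e) * s1 * s3 + s3 ^+ 2); first by ring.
  by rewrite E1 E2; ring.
move=> /eqP; rewrite mulf_eq0 !subr_eq0 => /orP[]/eqP ss.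
  by left; rewrite ss in E1; apply: mulIf E1; rewrite expf_neq0.
right; split.
  apply/is_squareP; exists (s3 / k); apply: (mulIf s1n).
  by rewrite expr_div_n -E3 ss; field; rewrite s1n s3n.
apply: (mulfI e0); rewrite mulfV //; apply: (mulIf (expf_neq0 2 s3n)).
by rewrite -mulrA -E1 -[in RHS]ss; ring.
Qed.

(** This keeps labels 0, 1, 2 apart from all later ones. *)
Lemma scaling_nongeneric (c u v w c' u' v' w' : F) :
  c' != 0 -> [|| u' != 0, v' != 0 | w' != 0] -> scaling c u v w c' u' v' w' ->
  c != 0 /\ [|| u != 0, v != 0 | w != 0].
Proof.
move=> c'n uvw [s1 [s2 [s3 [k [[s1n s2n s3n kn]]]]]].
have nz2 x : x != 0 -> x ^+ 2 != 0 :> F by move=> ?; rewrite expf_neq0.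
case=> [[Ec Eu Ev Ew]|[Ec Eu -> -> [v'0 w'0]]]; split.
- apply/eqP=> c0; move/esym/eqP: Ec.
  by rewrite c0 mul0r mulf_eq0 (negPf c'n) (negPf (nz2 _ s3n)).
- apply: contraTT uvw; rewrite !negb_or !negbK => /and3P[/eqP u0 /eqP v0 /eqP w0].
  have k0 x : 0 = k ^+ 2 * x -> x == 0.
    by move=> /esym/eqP; rewrite mulf_eq0 (negPf (nz2 _ kn)).
  by move: Eu Ev Ew; rewrite u0 v0 w0 !mul0r => /k0-> /k0-> /k0->.
- apply/eqP=> c0; move/esym/eqP: Ec; rewrite c0 mul0r mulf_eq0 (negPf (nz2 _ kn)) orbF.
  by move: uvw; rewrite v'0 w'0 eqxx !orbF => /negPf->.
- apply/orP; left; apply/eqP=> u0; move/esym/eqP: Eu.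
  by rewrite u0 mul0r mulf_eq0 (negPf c'n) (negPf (nz2 _ s3n)).
Qed.

Lemma scaling_eq0 (c u v w c' u' v' w' : F) : scaling c u v w c' u' v' w' ->
  (v == 0) = (v' == 0) /\ (w == 0) = (w' == 0).
Proof.
move=> [s1 [s2 [s3 [k [[s1n s2n s3n kn]]]]]].
case=> [[_ _ Ev Ew]|[_ _ -> -> [-> ->]]] //.
have zeroE x y s : s != 0 -> x * s = k ^+ 2 * y -> (x == 0) = (y == 0).
  move=> sn E; have: (x * s == 0) = (k ^+ 2 * y == 0) by rewrite E.
  by rewrite !mulf_eq0 (negPf sn) !(negPf kn) orbF.
by split; [apply: zeroE Ev | apply: zeroE Ew]; rewrite mulf_neq0.
Qed.

(** Labels 0, 1, 2 are separated by their square-zero elements, later ones by the zeros among v and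
    w, and 3 from 4 by u/c modulo squares. *)
Lemma label_forms_inl_neq (i : 'I_6) (l : label) :
  match l with inl j => (i < j)%N | inr e => e != 0 end ->
  ~ label_forms (inl i) ~~ label_forms l.
Proof.
have target c u v w c' u' v' w' : c' != 0 -> [|| u' != 0, v' != 0 | w' != 0] ->
    D c u v w ~~ D c' u' v' w' ->
    [/\ c != 0, [|| u != 0, v != 0 | w != 0]
      & (v == 0) = (v' == 0) /\ (w == 0) = (w' == 0)
        \/ (v == 0) = (w' == 0) /\ (w == 0) = (v' == 0)].
  move=> c'n uvw /(equiv_normal_forms_scaling two_neq0 c'n uvw)[] sc.
    have [] := scaling_nongeneric c'n uvw sc.
    by have := scaling_eq0 sc; split=> //; left.
  have [] := scaling_nongeneric c'n _ sc; first by rewrite [X in _ || X]orbC.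
  by have := scaling_eq0 sc; split=> //; right.
have n34 : ~ D 1 1 0 0 ~~ D 1 d 0 0.
  have d0 : d != 0.
    by apply: contraNneq nonsquare_d => ->; apply/is_squareP; exists 0; rewrite expr0n.
  have sc : ~ scaling 1 1 0 0 1 d 0 0.
    move=> [s1 [s2 [s3 [k [[s1n s2n s3n kn]]]]]] H; case/is_squareP: nonsquare_d.
    exists (s3 / k); apply: (mulIf (expf_neq0 2 kn)).
    rewrite expr_div_n divfK ?expf_neq0 //.
    by case: H => [[+ + _ _]|[+ + _ _ _]]; rewrite !mul1r => -> //; rewrite mulrC.
  move=> /(equiv_normal_forms_scaling two_neq0 (oner_neq0 _)).
  by rewrite d0 => /(_ isT)[].
have d0 : d != 0.
  by apply: contraNneq nonsquare_d => ->; apply/is_squareP; exists 0; rewrite expr0n.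
(* Vanishing of (v, w) for the labels after 2; it is an invariant only up to order, because of
   [swap12]. *)
pose pat (l : label) :=
  match l with inl j => (true, (j < 5)%N) | inr _ => (false, false) end.
have tgt (l' : label) c u v w : match l' with inl j => (2 < j)%N | inr e => e != 0 end ->
    D c u v w ~~ label_forms l' ->
    [/\ c != 0, [|| u != 0, v != 0 | w != 0]
      & (v == 0, w == 0) = pat l' \/ (w == 0, v == 0) = pat l'].
  case: l' => [[[|[|[|[|[|[|//]]]]]] lt_j]|e] //=; rewrite /pat /=.
  - move=> _ /target; rewrite oner_neq0 => /(_ isT isT)[-> ->].
    by rewrite eqxx => -[[-> ->]|[-> ->]]; split=> //; left.
  - move=> _ /target; rewrite oner_neq0 d0 => /(_ isT isT)[-> ->].
    by rewrite eqxx => -[[-> ->]|[-> ->]]; split=> //; left.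
  - move=> _ /target; rewrite oner_neq0 => /(_ isT isT)[-> ->].
    rewrite eqxx (negPf two_neq0).
    by case=> [[-> ->]|[-> ->]]; split=> //; [left | right].
  move=> e0 /target; rewrite mulf_neq0 // two_neq0 !orbT => /(_ isT isT)[-> ->].
  by rewrite (negPf two_neq0) => -[[-> ->]|[-> ->]]; split=> //; left.
case: i => [[|[|[|[|[|[|//]]]]]] lt_i];
  case: l => [[[|[|[|[|[|[|//]]]]]] lt_j]|e] //= lt_ij eqD.
all: try exact: (not_0000_1000 two_neq0 eqD).
all: try exact: (not_0000_0222 two_neq0 eqD).
all: try exact: (not_1000_0222 two_neq0 eqD).
all: try exact: (n34 eqD).
all: match type of lt_ij with
  | is_true (_ != _) => have := tgt (inr e) _ _ _ _ lt_ij eqD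
  | _ => have := tgt (inl (Ordinal lt_j)) _ _ _ _ isT eqD
  end; by case=> + + []; rewrite /pat /= ?eqxx ?oner_eq0 ?(negPf two_neq0).
Qed.

Definition label_reps :=
  [set l : label | if l is inr e then e \in inverse_reps F else true].

Lemma card_label_reps : #|label_reps| = (6 + #|inverse_reps F|)%N.
Proof.
have -> : label_reps = (inl @: [set: 'I_6]) :|: (inr @: inverse_reps F).
  apply/setP=> -[i|e]; rewrite in_setU [LHS]inE.
    by rewrite imset_f ?inE.
  apply/idP/orP=> [eR|[/imsetP[] //|/imsetP[e' e'R [->]]]] //.
  by right; apply: imset_f.
have disj : (inl @: [set: 'I_6]) :&: (inr @: inverse_reps F) = set0 :> {set label}.
  by apply/setP=> l; rewrite !inE; apply/negP=> /andP[/imsetP[? _ ->] /imsetP[]].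
rewrite cardsU disj cards0 subn0 !card_imset ?cardsT ?card_ord //.
  by move=> ? ? [].
by move=> ? ? [].
Qed.

Lemma label_reps_complete T :
  exists2 l, l \in label_reps & rel_form T ~~ label_forms l.
Proof.
have [a [b [g [c eqT]]]] := rel_form_ex two_neq0 T.
have [[i|e] le eqD] := label_exists a b g c.
  by exists (inl i); rewrite ?inE //; apply: equiv_forms_trans eqT eqD.
have eqTe := equiv_forms_trans eqT eqD.
have [eR|eR] := boolP (e \in inverse_reps F).
  by exists (inr e) => //; rewrite [_ \in _]inE.
move: eR; rewrite inE le negb_imply /= -ltnNge => /andP[sq_e /ltnW le_e].
exists (inr e^-1); last exact: equiv_forms_trans eqTe (family_inverse le sq_e).
by rewrite !inE invr_eq0 le is_squareV sq_e invrK.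
Qed.

Lemma label_reps_inj :
  {in label_reps &, forall l l', label_forms l ~~ label_forms l' -> l = l'}.
Proof.
have mixed (i : 'I_6) e :
    e \in inverse_reps F -> ~ label_forms (inl i) ~~ label_forms (inr e).
  by rewrite inE => /andP[e0 _]; apply: label_forms_inl_neq.
move=> [i|e] [j|e']; rewrite !inE => lS l'S eqD.
- have [ij|ji|/val_inj-> //] := ltngtP i j.
    by case: (@label_forms_inl_neq i (inl j) ij eqD).
  by case: (@label_forms_inl_neq j (inl i) ji (equiv_forms_sym eqD)).
- by case: (@mixed i e' _ eqD); rewrite inE.
- by case: (@mixed j e _ (equiv_forms_sym eqD)); rewrite inE.
case/andP: lS l'S => [e0 le_e] /andP[e'0 le_e'].
have [-> //|[sq_e e'E]] := family_scaling e0 e'0 eqD.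
move: le_e le_e'; rewrite e'E is_squareV invrK sq_e /= => le_e le_e'.
by congr inr; apply/enum_rank_inj/val_inj/eqP; rewrite eqn_leq le_e le_e'.
Qed.

Lemma num_classes4 : num_classes F 4 = (6 + #|inverse_reps F|)%N.
Proof.
have isoP T S := graded_isoP two_neq0 T S.
rewrite -card_label_reps; apply: (card_equivalence_partition (f := label_tower)).
- by move=> T; apply/asboolP/isoP/equiv_forms_refl.
- by move=> T S; apply/asboolP/asboolP=> /isoP/equiv_forms_sym/isoP.
- move=> T S U /asboolP/isoP ST /asboolP/isoP TU.
  exact/asboolP/isoP/(equiv_forms_trans ST TU).
- by move=> l _; rewrite inE label_tower_lower.
- move=> T _; have [l lS eqT] := label_reps_complete T; exists l => //.
  apply/asboolP/isoP/(equiv_forms_trans eqT)/equiv_forms_sym.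
  exact: rel_form_label_tower.
move=> l l' lS l'S /asboolP/isoP eqD; apply: label_reps_inj => //.
apply: equiv_forms_trans (equiv_forms_sym (rel_form_label_tower l)) _.
exact: equiv_forms_trans eqD (rel_form_label_tower l').
Qed.

End Classification.

Theorem theorem3p4 (F : finFieldType) (q : nat) (hq : #|F| = q)
    (hchar : 2%N \notin [pchar F]) :
  (q = 3 %[mod 4] ->
     (num_classes F 4)%:R = (3%:R * q%:R + 23%:R) / 4%:R :> rat) /\
  (q = 1 %[mod 4] ->
     (num_classes F 4)%:R = (3%:R * q%:R + 25%:R) / 4%:R :> rat).
Proof.
have two_neq0 : 2%:R != 0 :> F by rewrite inE in hchar.
have [d nsd] := nonsquare_ex two_neq0.
have [card3 card1] := card_inverse_reps two_neq0.
have quarter k : (4 * num_classes F 4 = 3 * q + k)%N ->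
    (num_classes F 4)%:R = (3%:R * q%:R + k%:R) / 4%:R :> rat.
  by move=> E; rewrite -natrM -natrD -E natrM mulrC mulKf.
(* This makes the truncated subtraction in [card3] exact; the six isolated classes then turn -1 and
   +1 into 23 and 25. *)
have q_gt1 : (1 < q)%N.
  by rewrite -hq -cardsT (cardsD1 0) inE (cardsD1 1) !inE oner_eq0.
rewrite -hq in quarter q_gt1 *.
split=> [/card3|/card1] cardR; apply: quarter; rewrite (num_classes4 two_neq0 nsd); lia.
Qed.
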